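(* For every real $\varepsilon$ with $0<\varepsilon<1/10$ there is a constant $c'=c'(\varepsilon)>0$ such that the following holds. Let $\lambda\in(0,1)$ and $\beta$ be real numbers with $0<\beta<(1-\varepsilon)\lambda(1-\lambda)$, let $n$ be a positive integer such that $\lambda n$ and $\beta n$ are integers, and let $k$ be any positive integer. Consider the slice $X=\binom{[n]}{\lambda n}$ endowed with the Johnson distance $\mathsf d$. (1) $(X,\mathsf d)$ has exponential growth at radius $\beta n$ with rate $\varepsilon^2$. (2) $(X,\mathsf d)$ is $(\beta n,k)$-dispersed with constant $\varepsilon/2$. (3) For any $a,b\in X$ with $\mathsf d(a,b)=k$ and any integer $i$ with $0\le i\le\varepsilon k$, $\ell_{a,b}(\mathbf x)-\mathbb E\,\ell_{a,b}(\mathbf x)$ is $8\beta n$-subgaussian, where $\mathbf x$ is drawn uniformly from $S(a,\beta n-i)$. Consequently, for every $a,b\in X$, $$\frac{|B(a,\beta n)\cap B(b,\beta n)|}{|B(a,\beta n)|}\le2\exp\left(-c'\left(\mathsf d(a,b)+\frac{\mathsf d(a,b)^2}{\beta n}\right)\right).$$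
   Context: $\binom{[n]}{w}$ is identified with the set of words in $\{0,1\}^n$ with exactly $w$ ones; the Johnson distance $\mathsf d(x,y)$ is half the number of coordinates in which $x,y$ differ. $B(a,s)=\{x\in X:\mathsf d(x,a)\le s\}$, $S(a,s)=\{x\in X:\mathsf d(x,a)=s\}$, and $\ell_{a,b}(x)=\mathsf d(x,b)-\mathsf d(x,a)$. Exponential growth at radius $r$ with rate $c$: for every $a\in X$ and every integer $t$ with $0\le t<r$, $|B(a,r-t)|\le2e^{-ct}|B(a,r)|$. $(r,k)$-dispersed with constant $\alpha$: for any $a,b\in X$ at distance exactly $k$ and any integer $i$ with $0\le i\le\alpha k$, $\mathbb E_{\mathbf x\sim S(a,r-i)}[\ell_{a,b}(\mathbf x)]\ge2\alpha k$, with $\mathbf x$ uniform on $S(a,r-i)$. A real random variable $\mathbf Y$ is $K$-subgaussian if $\mathbb P(|\mathbf Y|\ge t)\le2\exp(-t^2/K)$ for all $t\ge0$. Convention: conditions on a uniform random point of $S(a,r-i)$ are vacuous when $S(a,r-i)$ is empty. *)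

(* Defs.v *)
From HB Require Import structures.
From mathcomp Require Import all_boot all_order all_algebra.
From mathcomp Require Import reals sequences exp.

Set Implicit Arguments.
Unset Strict Implicit.
Unset Printing Implicit Defensive.

Import Order.TTheory GRing.Theory Num.Theory.
Local Open Scope ring_scope.

Definition weight (n : nat) (x : {ffun 'I_n -> bool}) : nat :=
  #|[set j | x j]|.

Record slice (n w : nat) := Slice {
  word :> {ffun 'I_n -> bool};
  _ : weight word == w
}.

HB.instance Definition _ (n w : nat) := [isSub for @word n w].
HB.instance Definition _ (n w : nat) := [Finite of slice n w by <:].

(* The halving is exact on a slice: see [jdist_double]. *)
Definition jdist (n w : nat) (x y : slice n w) : nat :=
  #|[set j | x j != y j]|./2.

Lemma jdist_double (n w : nat) (x y : slice n w) :
  (jdist x y).*2 = #|[set j | x j != y j]|.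
Proof.
rewrite /jdist; set A := [set j | x j]; set B := [set j | y j].
have -> : [set j | x j != y j] = (A :\: B) :|: (B :\: A).
  by apply/setP => j; rewrite !inE; case: (x j); case: (y j).
have cA : #|A| = w by apply/eqP; exact: (valP x).
have cB : #|B| = w by apply/eqP; exact: (valP y).
have -> : #|(A :\: B) :|: (B :\: A)| = #|A :\: B|.*2.
  rewrite cardsU; have -> : (A :\: B) :&: (B :\: A) = set0.
    by apply/setP => j; rewrite !inE; case: (x j); case: (y j).
  by rewrite cards0 subn0 -addnn; congr addn; rewrite !cardsD cA cB setIC.
by rewrite doubleK.
Qed.

(* Radii range over [int], so that balls and spheres of negative radius are
   empty; with radii in [nat], truncated subtraction would identify them with
   balls and spheres of radius 0. *)
Definition dball (T : finType) (d : T -> T -> nat) (a : T) (s : int) : {set T} :=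
  [set x | (d x a)%:Z <= s].

Definition dsphere (T : finType) (d : T -> T -> nat) (a : T) (s : int) :
  {set T} := [set x | (d x a)%:Z == s].

Definition ell (R : realType) (T : finType) (d : T -> T -> nat) (a b x : T) : R :=
  (d x b)%:R - (d x a)%:R.

(* Expectation and probability for the uniform law on a nonempty finite set. *)
Definition unif_E (R : realType) (T : finType) (A : {set T}) (f : T -> R) : R :=
  (\sum_(x in A) f x) / #|A|%:R.

Definition unif_P (R : realType) (T : finType) (A : {set T}) (P : pred T) : R :=
  #|[set x in A | P x]|%:R / #|A|%:R.

Definition subgaussian (R : realType) (T : finType) (A : {set T}) (Y : T -> R)
    (K : R) : Prop :=
  forall t : R, 0 <= t ->
    unif_P R A (fun x => t <= `|Y x|) <= 2 * expR (- (t ^+ 2 / K)).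

Definition exp_growth (R : realType) (T : finType) (d : T -> T -> nat)
    (r : int) (c : R) : Prop :=
  forall (a : T) (t : int), 0 <= t -> t < r ->
    #|dball d a (r - t)|%:R <= 2 * expR (- (c * t%:~R)) * #|dball d a r|%:R :> R.

Definition dispersed (R : realType) (T : finType) (d : T -> T -> nat)
    (r : int) (k : nat) (alpha : R) : Prop :=
  forall a b : T, d a b = k ->
  forall i : int, 0 <= i -> i%:~R <= alpha * k%:R ->
    dsphere d a (r - i) != set0 ->
    2 * alpha * k%:R <= unif_E (dsphere d a (r - i)) (ell R d a b).

(* Main.v *)
Require Import Defs.
From mathcomp Require Import all_boot all_order all_algebra.
From mathcomp Require Import reals sequences exp.
From mathcomp Require Import ring lra zify.

(** Fix a centre [a] and write a word [x] as the pair [(U, V)] of the ones of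
    [a] that [x] drops and the zeros of [a] that it turns into ones.  A uniform
    point of the sphere of radius [s] is then a pair of independent uniform
    [s]-subsets, of the [w] ones and of the [n - w] zeros ([sum_sphere]).  If
    [b] is at distance [k] from [a], and [D1], [D2] are the [k]-sets of ones of
    [a] missing from [b] and of ones of [b] missing from [a], then
      ell x = k - #|U :&: D1| - #|V :&: D2|      ([ell_cap]),
    so [ell] is a constant minus two independent hypergeometric variables.

    Growth: the sphere sizes are ['C(w, s) * 'C(n - w, s)], with consecutive
    ratio [(w - s)(n - w - s) / (s + 1)^2]; the hypothesis on [beta], that is
    [r n < (1 - eps) w (n - w)], keeps it at least [1 + eps >= exp (eps^2)] up
    to radius [r] ([card_sphere_growth]).

    Dispersion: [ell] has mean [k (1 - s n / (w (n - w)))], which the same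
    inequality bounds below by [eps k] ([ell_mean], [mean_ell_ge]).

    Concentration: a hypergeometric variable counting the elements of a
    [k]-set in a random [s]-set has centred moment generating function at
    [theta] at most [exp (theta^2 min(s, k))] ([draw_mgf_le]).  Revealing
    the marked elements one by one gives the factor [k], and exchanging the
    roles of the drawn and the marked set gives [s].  Chernoff's bound with
    [s <= r] is the subgaussian claim.

    Intersection of balls: let [alpha = eps / 2].  A point of both balls at
    distance less than [r - alpha k] from [a] is rare by growth; any other one
    has [ell x <= alpha k], while the mean of [ell] is at least [2 alpha k].
    Here the tail with variance proxy of order [k] is the right one: it gives
    [exp (- alpha^2 k / 8)], whereas the proxy [r] would give only
    [exp (- alpha^2 k^2 / (8 r))], too weak when [k] is smaller than [r].  The
    quadratic term of the conclusion is then free, because the balls are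
    disjoint unless [k <= 2 r], and in that case [k^2 / r <= 2 k]. *)

Set Implicit Arguments.
Unset Strict Implicit.
Unset Printing Implicit Defensive.

Import Order.TTheory GRing.Theory Num.Theory.
Local Open Scope ring_scope.

(** * Exponential moments of a Bernoulli variable *)

(** For [x >= 0], multiply [exp (x^2 - x) >= 1 + x^2 - x] by [exp x] and absorb
    the defect with [exp (- x) >= 1 - x]; for [x < 0] the quadratic bound
    [exp x <= 1 + x + x^2] holds. *)
Lemma expR_le_add_expR_sq (R : realType) (x : R) : expR x <= x + expR (x ^+ 2).
Proof.
have e0 := expR_gt0 x.
have eN : expR x * (1 - x) <= 1.
  by rewrite -[leRHS](expRxMexpNx_1 x) ler_pM2l // expR_ge1Dx.
have [x0|x0] := leP 0 x.
  have : expR x * (1 + (x ^+ 2 - x)) <= expR (x ^+ 2).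
    rewrite -[in leRHS](subrK x (x ^+ 2)) [x ^+ 2 - x + x]addrC expRD ler_pM2l //.
    exact: expR_ge1Dx.
  nra.
have x2 := expR_ge1Dx (x ^+ 2).
suff : expR x <= 1 + x + x ^+ 2 by lra.
have x1 : 0 < 1 - x by lra.
rewrite -(ler_pM2r x1); apply: (le_trans eN).
have := sqr_ge0 x; nra.
Qed.

(** After division by [exp (p x)] the variable is centred, so the linear terms
    of [expR_le_add_expR_sq] at its two values cancel. *)
Lemma bernoulli_mgf_le (R : realType) (p x : R) : 0 <= p -> p <= 1 ->
  p * expR x + (1 - p) <= expR (p * x + x ^+ 2).
Proof.
move=> p0 p1; have e0 := expR_gt0 (p * x).
suff H : p * expR ((1 - p) * x) + (1 - p) * expR (- (p * x)) <= expR (x ^+ 2).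
  have -> : p * expR x + (1 - p) =
      expR (p * x) * (p * expR ((1 - p) * x) + (1 - p) * expR (- (p * x))).
    rewrite mulrDr mulrCA -expRD mulrCA expRxMexpNx_1 mulr1.
    by congr (_ * expR _ + _); ring.
  by rewrite expRD ler_pM2l.
have A := expR_le_add_expR_sq ((1 - p) * x).
have B := expR_le_add_expR_sq (- (p * x)).
have A' : expR (((1 - p) * x) ^+ 2) <= expR (x ^+ 2).
  rewrite ler_expR exprMn ler_piMl ?sqr_ge0 // expr_le1 //; lra.
have B' : expR ((- (p * x)) ^+ 2) <= expR (x ^+ 2).
  by rewrite ler_expR sqrrN exprMn ler_piMl ?sqr_ge0 // expr_le1.
have p1' : 0 <= 1 - p by lra.
have A2 := ler_wpM2l p0 (le_trans A (lerD (lexx _) A')).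
have B2 := ler_wpM2l p1' (le_trans B (lerD (lexx _) B')).
lra.
Qed.

(** * Uniform draws of [s] elements from a finite set *)

Section Draws.
Variables (T : finType).
Implicit Types (A D U : {set T}).

Lemma big_draw_recS (R : nmodType) (A : {set T}) (d : T) s (F : {set T} -> R) :
  d \in A ->
  \sum_(U : {set T} | (U \subset A) && (#|U| == s.+1)) F U =
  \sum_(U : {set T} | (U \subset A :\ d) && (#|U| == s)) F (d |: U) +
  \sum_(U : {set T} | (U \subset A :\ d) && (#|U| == s.+1)) F U.
Proof.
move=> dA; rewrite (bigID (fun U => d \in U)) /=; congr (_ + _).
  rewrite (reindex_onto (fun U => d |: U) (fun U => U :\ d)) /=; last first.
    by move=> U /andP[_ dU]; rewrite setD1K.
  apply: eq_bigl => U; rewrite setU11 andbT subUset sub1set dA /=.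
  rewrite subsetD1 cardsU1; have [dU|dU] := boolP (d \in U).
    rewrite /= !andbF; apply/andP => -[_ /eqP E].
    by move: dU; rewrite -E setD11.
  by rewrite /= add1n eqSS setU1K // eqxx !andbT.
apply: eq_bigl => U; rewrite subsetD1.
by rewrite -!andbA; congr (_ && _); rewrite andbC.
Qed.

Lemma big_draw0 (R : nmodType) (A : {set T}) (F : {set T} -> R) :
  \sum_(U : {set T} | (U \subset A) && (#|U| == 0)%N) F U = F set0.
Proof.
rewrite (bigD1 set0) /= ?sub0set ?cards0 ?eqxx // big1 ?addr0 // => U.
by rewrite cards_eq0 => /andP[/andP[_ ->]].
Qed.

Lemma sum_draw1 (R : pzRingType) A s :
  \sum_(U : {set T} | (U \subset A) && (#|U| == s)) 1 = 'C(#|A|, s)%:R :> R.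
Proof.
by rewrite -cards_draws -sum1_card natr_sum; apply: eq_bigl => U; rewrite inE.
Qed.

Lemma card_cap_add A D d U : d \in D -> U \subset A :\ d ->
  #|(d |: U) :&: D| = #|U :&: (D :\ d)|.+1.
Proof.
move=> dD; rewrite subsetD1 => /andP[_ dU].
have -> : (d |: U) :&: D = d |: (U :&: (D :\ d)).
  apply/setP => x; rewrite !inE; case: eqP => [->|_] //=.
by rewrite cardsU1 !inE eqxx andbF.
Qed.

Lemma card_cap_del A D d U : U \subset A :\ d ->
  #|U :&: D| = #|U :&: (D :\ d)|.
Proof.
rewrite subsetD1 => /andP[_ dU]; congr #|pred_of_set _|.
apply/setP => x; rewrite !inE; case: eqP => [->|_] //=.
by rewrite (negPf dU).
Qed.

(** Conditioning on whether the marked element [d] is drawn. *)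
Lemma draw_pgf_recS (R : comPzRingType) (z : R) A D d s : d \in D -> d \in A ->
  \sum_(U : {set T} | (U \subset A) && (#|U| == s.+1)) z ^+ #|U :&: D| =
  z * \sum_(U : {set T} | (U \subset A :\ d) && (#|U| == s))
        z ^+ #|U :&: (D :\ d)| +
  \sum_(U : {set T} | (U \subset A :\ d) && (#|U| == s.+1))
        z ^+ #|U :&: (D :\ d)|.
Proof.
move=> dD dA; rewrite (big_draw_recS _ _ dA) mulr_sumr; congr (_ + _).
  by apply: eq_bigr => U /andP[UA _]; rewrite (card_cap_add dD UA) exprS.
by apply: eq_bigr => U /andP[UA _]; rewrite (card_cap_del D UA).
Qed.

(** The law of the number of marked elements drawn depends on the cardinals
    only; this is what lets drawn and marked sets be exchanged in
    [draw_mgf_le]. *)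
Lemma draw_pgf_card (R : comPzRingType) (z : R) A1 A2 D1 D2 s :
  D1 \subset A1 -> D2 \subset A2 -> #|A1| = #|A2| -> #|D1| = #|D2| ->
  \sum_(U : {set T} | (U \subset A1) && (#|U| == s)) z ^+ #|U :&: D1| =
  \sum_(U : {set T} | (U \subset A2) && (#|U| == s)) z ^+ #|U :&: D2|.
Proof.
move: {2}#|D1| (erefl #|D1|) => k.
elim: k => [|k IH] in A1 A2 D1 D2 s *.
  move=> D10 _ _ eA; rewrite D10 => /esym D20.
  move: D10 D20 => /cards0_eq-> /cards0_eq->.
  have E A : \sum_(U : {set T} | (U \subset A) && (#|U| == s))
      z ^+ #|U :&: set0| = 'C(#|A|, s)%:R.
    by rewrite -sum_draw1; apply: eq_bigr => U _; rewrite setI0 cards0 expr0.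
  by rewrite !E eA.
move=> cD1 s1 s2 eA eD.
case: s => [|s]; first by rewrite !big_draw0 !set0I.
have /card_gt0P[d1 d1D] : (0 < #|D1|)%N by rewrite cD1.
have /card_gt0P[d2 d2D] : (0 < #|D2|)%N by rewrite -eD cD1.
have d1A := subsetP s1 _ d1D; have d2A := subsetP s2 _ d2D.
rewrite (draw_pgf_recS z s d1D d1A) (draw_pgf_recS z s d2D d2A).
have cA : #|A1 :\ d1| = #|A2 :\ d2|.
  have := eA; rewrite (cardsD1 d1) d1A (cardsD1 d2 A2) d2A => /eqP.
  by rewrite eqn_add2l => /eqP.
have cD : #|D1 :\ d1| = k.
  by move: cD1; rewrite (cardsD1 d1) d1D add1n => -[].
have cD' : #|D1 :\ d1| = #|D2 :\ d2|.
  rewrite cD; move: cD1; rewrite eD (cardsD1 d2) d2D add1n => -[] ->//.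
have S1 : D1 :\ d1 \subset A1 :\ d1 by exact: setSD.
have S2 : D2 :\ d2 \subset A2 :\ d2 by exact: setSD.
by congr (_ * _ + _); apply: IH.
Qed.

(** For [s <= w], [p] is the probability that a given element belongs to a
    uniform [s.+1]-subset of a set of size [w.+1]. *)
Lemma bin_split_ratio (R : realType) w s (p := s.+1%:R / w.+1%:R : R) :
  'C(w, s)%:R = 'C(w.+1, s.+1)%:R * p /\
  'C(w, s.+1)%:R = 'C(w.+1, s.+1)%:R * (1 - p).
Proof.
have w0 : w.+1%:R != 0 :> R by rewrite pnatr_eq0.
have E : 'C(w, s)%:R = 'C(w.+1, s.+1)%:R * p.
  have /(congr1 (fun m => m%:R : R)) := mul_bin_diag w.+1 s.
  rewrite !natrM /= /p => H; apply: (mulfI w0); rewrite H.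
  by rewrite mulrCA [_ * (_ / _)]mulrCA divff // mulr1 mulrC.
split=> //.
have : 'C(w.+1, s.+1)%:R = 'C(w, s)%:R + 'C(w, s.+1)%:R :> R.
  by rewrite -natrD binS addnC.
rewrite E; lra.
Qed.

(** Induction on the marked set: whether a marked [d] is drawn is a Bernoulli
    variable of parameter [p], and drawing it raises the expected total count
    by at least 0 and at most 1.  Each marked element thus costs one application
    of [bernoulli_mgf_le], at an argument not exceeding [theta] in absolute
    value. *)
Lemma draw_mgf_le_marked (R : realType) (theta : R) A D s : D \subset A ->
  \sum_(U : {set T} | (U \subset A) && (#|U| == s)) expR theta ^+ #|U :&: D| <=
  'C(#|A|, s)%:R *
    expR (theta * (s%:R * #|D|%:R / #|A|%:R) + theta ^+ 2 * #|D|%:R).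
Proof.
move: {2}#|D| (erefl #|D|) => k.
elim: k => [|k IH] in A D s *.
  move=> /cards0_eq-> _; rewrite cards0 !mulr0 mul0r mulr0 addr0 expR0 mulr1.
  by rewrite -sum_draw1; apply: ler_sum => U _; rewrite setI0 cards0 expr0.
move=> cD sDA.
case: s => [|s].
  rewrite big_draw0 set0I cards0 expr0 bin0 !mul1r !mul0r mulr0 add0r.
  by rewrite -[leLHS]expR0 ler_expR mulr_ge0 ?sqr_ge0.
have /card_gt0P[d dD] : (0 < #|D|)%N by rewrite cD.
have dA := subsetP sDA _ dD.
rewrite (draw_pgf_recS _ s dD dA).
have cD' : #|D :\ d| = k.
  by move: cD; rewrite (cardsD1 d) dD add1n => -[].
have S : D :\ d \subset A :\ d by exact: setSD.
have [w cA'] : {w | #|A :\ d| = w} by exists #|A :\ d|.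
have cA : #|A| = w.+1 by rewrite (cardsD1 d) dA cA'.
have kw : (k <= w)%N by rewrite -cD' -cA' subset_leq_card.
have H1 := IH _ _ s cD' S; have H2 := IH _ _ s.+1 cD' S.
rewrite cA' cD' in H1 H2; rewrite cA cD.
have [E1 E2] := bin_split_ratio R w s.
rewrite E1 in H1; rewrite {}E2 {E1} in H2.
set C := 'C(w.+1, s.+1)%:R in H1 H2 *.
set p := s.+1%:R / w.+1%:R in H1 H2.
have [ws|sw] := ltnP w s.
  have C0 : C = 0 by rewrite /C bin_small.
  rewrite !C0 !mul0r in H1 H2 *; have := expR_gt0 theta; nra.
have [C0 p0] : 0 <= C /\ 0 <= p by split; rewrite ?divr_ge0.
have p1 : p <= 1 by rewrite ler_pdivrMr ?mul1r ?ler_nat ?ltr0n.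
(* [kap] is the density of marked elements left after removing [d]: drawing [d]
   raises the expected final count by [1 - kap]. *)
pose kap : R := k%:R / w%:R.
have kapw : kap * w%:R = k%:R.
  rewrite /kap; case: (posnP w) kw => [->|w0 _]; last first.
    by rewrite mulfVK // pnatr_eq0 -lt0n.
  by rewrite leqn0 => /eqP->; rewrite mulr0.
have pw : p * (w%:R + 1) = s%:R + 1.
  by rewrite /p -!natr1 mulfVK // gt_eqF // ltr_wpDl.
have -> : s.+1%:R * k.+1%:R / w.+1%:R = p * k.+1%:R by rewrite mulrAC.
have := ler_wpM2l (ltW (expR_gt0 theta)) H1.
move=> H1'; apply: (le_trans (lerD H1' H2)) => {H1 H2 H1'}.
rewrite -![_ * k%:R / w%:R]mulrA -/kap.
set x := theta * (1 - kap).
have kap0 : 0 <= kap by rewrite divr_ge0.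
have kap1 : kap <= 1.
  rewrite /kap; case: (posnP w) => [->|w0]; first by rewrite invr0 mulr0.
  by rewrite ler_pdivrMr ?ltr0n // mul1r ler_nat.
have B := bernoulli_mgf_le x p0 p1.
set E := theta * (s.+1%:R * kap) + theta ^+ 2 * k%:R.
set E' := theta * (s%:R * kap) + theta ^+ 2 * k%:R.
have -> : expR theta * (C * p * expR E') = C * (expR E * (p * expR x)).
  have -> : expR E * (p * expR x) = p * (expR theta * expR E').
    rewrite mulrCA -!expRD; congr (_ * expR _).
    by rewrite /E /E' /x -natr1; ring.
  by ring.
have -> : C * (1 - p) * expR E = C * (expR E * (1 - p)) by ring.
rewrite -mulrDr -mulrDr ler_wpM2l //.
apply: (le_trans (ler_wpM2l (expR_ge0 _) B)).
rewrite -expRD ler_expR /E -!natr1.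
have -> : s%:R + 1 = p * (w%:R + 1) :> R by [].
have -> : p * x = theta * p - theta * p * kap by rewrite /x; ring.
have -> : theta * (p * (w%:R + 1) * kap) =
  theta * p * (kap * w%:R) + theta * p * kap by ring.
rewrite kapw.
have : x ^+ 2 <= theta ^+ 2.
  by rewrite exprMn ler_piMr ?sqr_ge0 // expr_le1 //; lra.
lra.
Qed.

(** The law of [#|U :&: D|] is symmetric in the drawn set [U] and the marked set
    [D]: average the sum over all [D'] of the size of [D] and exchange the
    two summations.  This turns the factor [#|D|] of [draw_mgf_le_marked] into
    [s]. *)
Lemma draw_mgf_le (R : realType) (theta : R) A D s : D \subset A ->
  \sum_(U : {set T} | (U \subset A) && (#|U| == s)) expR theta ^+ #|U :&: D| <=
  'C(#|A|, s)%:R *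
    expR (theta * (s%:R * #|D|%:R / #|A|%:R) + theta ^+ 2 * (minn s #|D|)%:R).
Proof.
move=> sDA; have [Ds|sD] := leqP #|D| s; first by exact: draw_mgf_le_marked.
have C0 : 0 < 'C(#|A|, #|D|)%:R :> R by rewrite ltr0n bin_gt0 subset_leq_card.
rewrite -(ler_pM2l C0) -[X in X * _](sum_draw1 R A) mulr_suml.
set M := \sum_(U : {set T} | (U \subset A) && (#|U| == s)) _.
have -> : \sum_(i : {set T} | (i \subset A) && (#|i| == #|D|)) 1 * M =
  \sum_(D' : {set T} | (D' \subset A) && (#|D'| == #|D|))
   \sum_(U : {set T} | (U \subset A) && (#|U| == s)) expR theta ^+ #|D' :&: U|.
  apply: eq_bigr => D' /andP[sD' /eqP cD']; rewrite mul1r /M.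
  rewrite (draw_pgf_card (expR theta) s sDA sD' (erefl _)) //.
  by apply: eq_bigr => U _; rewrite setIC.
rewrite exchange_big /=.
pose B := 'C(#|A|, #|D|)%:R *
  expR (theta * (s%:R * #|D|%:R / #|A|%:R) + theta ^+ 2 * s%:R).
apply: (@le_trans _ _ (\sum_(U : {set T} | (U \subset A) && (#|U| == s)) 1 * B)).
  apply: ler_sum => U /andP[sU /eqP cU]; rewrite mul1r.
  apply: (le_trans (draw_mgf_le_marked theta #|D| sU)).
  by rewrite cU /B [#|D|%:R * s%:R]mulrC.
by rewrite -mulr_suml sum_draw1 mulrCA.
Qed.

Lemma draw_mean (R : realType) A D s : D \subset A ->
  \sum_(U : {set T} | (U \subset A) && (#|U| == s)) #|U :&: D|%:R =
  'C(#|A|, s)%:R * (s%:R * #|D|%:R / #|A|%:R) :> R.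
Proof.
move=> sDA.
under eq_bigr => U _.
  rewrite -sum1_card natr_sum (eq_bigl (fun d => (d \in D) && (d \in U))); last first.
    by move=> d; rewrite inE andbC.
  rewrite big_mkcondr /=.
  over.
rewrite exchange_big /=.
have -> : 'C(#|A|, s)%:R * (s%:R * #|D|%:R / #|A|%:R) =
  \sum_(d in D) ('C(#|A|, s)%:R * (s%:R / #|A|%:R)) :> R.
  by rewrite sumr_const -[RHS]mulr_natr; ring.
apply: eq_bigr => d dD; have dA := subsetP sDA _ dD.
rewrite -big_mkcondr /=; case: s => [|s].
  rewrite mul0r mulr0 big1 // => U /andP[/andP[_]].
  by rewrite cards_eq0 => /eqP->; rewrite inE.
rewrite big_mkcondr (big_draw_recS _ _ dA).
rewrite [X in _ + X]big1 ?addr0; last first.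
  by move=> U /andP[]; rewrite subsetD1 => /andP[_ /negPf->].
under eq_bigr do rewrite setU11.
rewrite sum_draw1.
have cA : #|A| = #|A :\ d|.+1 by rewrite (cardsD1 d) dA.
by rewrite cA; case: (bin_split_ratio R #|A :\ d| s).
Qed.
End Draws.

(** * The sphere of a slice as a product of two families of draws *)

Section Slice.
Variables n w : nat.
Implicit Types a b x : slice n w.

Definition ones x : {set 'I_n} := [set j | x j].

Lemma card_ones x : #|ones x| = w.
Proof. by apply/eqP; exact: (valP x). Qed.

Lemma card_zeros x : #|~: ones x| = (n - w)%N.
Proof. by rewrite cardsCs setCK card_ones card_ord. Qed.

Lemma jdistC x y : jdist x y = jdist y x.
Proof. by congr (_)./2; apply: eq_card => j; rewrite !inE eq_sym. Qed.

Lemma card_onesD x y : #|ones x :\: ones y| = jdist x y.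
Proof.
apply: double_inj; rewrite jdist_double.
have -> : [set j | x j != y j] = (ones x :\: ones y) :|: (ones y :\: ones x).
  by apply/setP => j; rewrite !inE; case: (x j); case: (y j).
rewrite cardsU; have -> : (ones x :\: ones y) :&: (ones y :\: ones x) = set0.
  by apply/setP => j; rewrite !inE; case: (x j); case: (y j).
rewrite cards0 subn0 -addnn; congr addn.
by rewrite !cardsD !card_ones setIC.
Qed.

Lemma jdist_triangle x y z : (jdist x z <= jdist x y + jdist y z)%N.
Proof.
rewrite -!card_onesD; apply: leq_trans (leq_card_setU _ _).
apply: subset_leq_card; apply/subsetP => j; rewrite !inE.
by case: (x j); case: (y j); case: (z j).
Qed.

(** Each of the [2 s] positions flipped from [a] to [x], where [s] is the
    distance between them, adds one half to the distance to [b] if [a] and [b]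
    agree there and removes one half if they differ. *)
Lemma jdist_swap a b x :
  (jdist x b + #|(ones a :\: ones x) :&: (ones a :\: ones b)|
    + #|(ones x :\: ones a) :&: (ones b :\: ones a)| = jdist a b + jdist x a)%N.
Proof.
rewrite (jdistC x b) (jdistC x a) (jdistC a b) -!card_onesD.
have E1 : (#|ones b :\: ones x| = #|(ones a :&: ones b) :\: ones x| +
   #|(ones b :\: ones a) :\: ones x|)%N.
  rewrite -(cardsID (ones a)); congr (_ + _)%N; apply: eq_card => j;
  by rewrite !inE; case: (x j); case: (a j); case: (b j).
have E2 : (#|ones a :\: ones x| = #|(ones a :&: ones b) :\: ones x| +
   #|(ones a :\: ones x) :&: (ones a :\: ones b)|)%N.
  rewrite -(cardsID (ones b)); congr (_ + _)%N; apply: eq_card => j;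
  by rewrite !inE; case: (x j); case: (a j); case: (b j).
have E3 : (#|ones b :\: ones a| =
   #|(ones x :\: ones a) :&: (ones b :\: ones a)| +
   #|(ones b :\: ones a) :\: ones x|)%N.
  rewrite -(cardsID (ones x)); congr (_ + _)%N; apply: eq_card => j;
  by rewrite !inE; case: (x j); case: (a j); case: (b j).
lia.
Qed.

Lemma in_sphere a (s : nat) x :
  (x \in dsphere (@jdist n w) a s) = (jdist x a == s).
Proof. by rewrite inE eqz_nat. Qed.

Lemma in_ball a (s : nat) x :
  (x \in dball (@jdist n w) a s) = (jdist x a <= s)%N.
Proof. by rewrite inE lez_nat. Qed.

(** On a uniform point of a sphere, the set of dropped ones and the set of
    added ones are independent uniform draws. *)
Lemma sum_sphere (R : comPzRingType) a (s : nat) (f g : {set 'I_n} -> R) :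
  \sum_(x in dsphere (@jdist n w) a s)
    f (ones a :\: ones x) * g (ones x :\: ones a) =
  (\sum_(U : {set 'I_n} | (U \subset ones a) && (#|U| == s)) f U) *
  (\sum_(V : {set 'I_n} | (V \subset ~: ones a) && (#|V| == s)) g V).
Proof.
rewrite big_distrlr pair_big /=.
pose h x := (ones a :\: ones x, ones x :\: ones a).
pose sw (p : {set 'I_n} * {set 'I_n}) := (ones a :\: p.1) :|: p.2.
(* [insubd] needs a default word, but on the pairs in the range of the sum
   [sw p] has weight [w] and the default is never taken. *)
pose h' p : slice n w := insubd a [ffun j => j \in sw p].
rewrite (reindex_onto h h') /=; last first.
  move=> [U V] /= /andP[/andP[sU /eqP cU] /andP[sV /eqP cV]].
  have E : ones (h' (U, V)) = sw (U, V).
    have -> : ones (h' (U, V)) = [set j | [ffun j => j \in sw (U, V)] j].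
      rewrite /ones /h' val_insubd.
      suff -> : weight [ffun j => j \in sw (U, V)] == w by [].
      rewrite /weight (_ : [set _ | _] = sw (U, V)); last first.
        by apply/setP => j; rewrite inE ffunE.
      rewrite /sw /= cardsU (_ : _ :&: V = set0); last first.
        apply/setP => j; rewrite !inE; have := subsetP sV j; rewrite !inE.
        by case: (j \in V) => [/(_ isT)/negPf->|_]; rewrite ?andbF.
      rewrite cards0 subn0 cardsD (setIidPr sU) cU cV card_ones subnK //.
      by rewrite -(card_ones a) -cU subset_leq_card.
    by apply/setP => j; rewrite inE ffunE.
  rewrite /h E /sw /=; congr pair; apply/setP => j; rewrite !inE;
  have := subsetP sV j; have := subsetP sU j; rewrite !inE.
    by case: (j \in U); case: (a j); case: (j \in V) => //= A B;
     try (by have := A isT); try (by have := B isT).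
  by case: (j \in U); case: (a j); case: (j \in V) => //= A B;
     try (by have := A isT); try (by have := B isT).
apply: eq_bigl => x; rewrite in_sphere subsetDl /=.
have -> : ones x :\: ones a \subset ~: ones a by rewrite setDE subsetIr.
rewrite !card_onesD (jdistC a x) /= andbb.
suff -> : h' (h x) = x by rewrite eqxx andbT.
apply/val_inj; rewrite /h' val_insubd.
suff -> : [ffun j => j \in sw (h x)] = val x by rewrite (valP x).
apply/ffunP => j; rewrite ffunE !inE.
by case: (a j); case: (x j).
Qed.

Lemma sum_drop (R : comPzRingType) a s :
  \sum_(U : {set 'I_n} | (U \subset ones a) && (#|U| == s)) 1 = 'C(w, s)%:R :> R.
Proof. by rewrite sum_draw1 card_ones. Qed.

Lemma sum_add (R : comPzRingType) a s :
  \sum_(V : {set 'I_n} | (V \subset ~: ones a) && (#|V| == s)) 1 =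
  'C(n - w, s)%:R :> R.
Proof. by rewrite sum_draw1 card_zeros. Qed.

Lemma card_sphere a (s : nat) :
  #|dsphere (@jdist n w) a s| = ('C(w, s) * 'C(n - w, s))%N.
Proof.
apply/eqP; rewrite -(eqr_nat int) natrM -(sum_drop _ a) -(sum_add _ a).
rewrite -(sum_sphere _ _ (fun=> 1) (fun=> 1)) -sum1_card natr_sum.
by under [X in _ == X]eq_bigr do rewrite mulr1.
Qed.

Lemma sum_ball (R : nmodType) a (s : nat) (F : slice n w -> R) :
  \sum_(x in dball (@jdist n w) a s) F x =
  \sum_(i < s.+1) \sum_(x in dsphere (@jdist n w) a i) F x.
Proof.
rewrite (partition_big (fun x => inord (jdist x a) : 'I_s.+1) predT) //=.
apply: eq_bigr => i _; apply: eq_bigl => x; rewrite in_ball in_sphere.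
apply/andP/eqP => [[xs /eqP <-]|xi]; first by rewrite inordK.
by rewrite xi -ltnS ltn_ord inord_val.
Qed.

Lemma card_ball_sum a (s : nat) :
  (#|dball (@jdist n w) a s| = \sum_(i < s.+1) #|dsphere (@jdist n w) a i|)%N.
Proof.
rewrite -sum1_card; under [RHS]eq_bigr do rewrite -sum1_card.
exact: (sum_ball a s (fun=> 1%N)).
Qed.

Lemma ell_cap (R : realType) a b x :
  ell R (@jdist n w) a b x = (jdist a b)%:R
   - #|(ones a :\: ones x) :&: (ones a :\: ones b)|%:R
   - #|(ones x :\: ones a) :&: (ones b :\: ones a)|%:R.
Proof.
rewrite /ell; have /(congr1 (fun m => m%:R : R)) := jdist_swap a b x.
rewrite !natrD; lra.
Qed.

Definition mean_ell (R : realType) (s k : nat) : R :=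
  k%:R - s%:R * k%:R / w%:R - s%:R * k%:R / (n - w)%:R.

Lemma onesD_sub a b : ones a :\: ones b \subset ones a.
Proof. exact: subsetDl. Qed.
Lemma onesD_subC a b : ones b :\: ones a \subset ~: ones a.
Proof. by rewrite setDE subsetIr. Qed.

Lemma ell_mean (R : realType) a b (s : nat) :
  dsphere (@jdist n w) a s != set0 ->
  unif_E (dsphere (@jdist n w) a s) (ell R (@jdist n w) a b) =
  mean_ell R s (jdist a b).
Proof.
rewrite -card_gt0 => S0.
rewrite /unif_E; under eq_bigr do rewrite ell_cap.
rewrite !sumrB.
have -> : \sum_(x in dsphere (@jdist n w) a s)
    #|(ones a :\: ones x) :&: (ones a :\: ones b)|%:R =
   #|dsphere (@jdist n w) a s|%:R * (s%:R * (jdist a b)%:R / w%:R) :> R.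
  rewrite card_sphere natrM mulrAC.
  have := draw_mean R s (onesD_sub a b); rewrite card_ones card_onesD => <-.
  rewrite -(sum_add R a).
  rewrite -(sum_sphere _ _ (fun U => #|U :&: (ones a :\: ones b)|%:R) (fun=> 1)).
  by under [RHS]eq_bigr do rewrite mulr1.
have -> : \sum_(x in dsphere (@jdist n w) a s)
    #|(ones x :\: ones a) :&: (ones b :\: ones a)|%:R =
   #|dsphere (@jdist n w) a s|%:R * (s%:R * (jdist a b)%:R / (n - w)%:R) :> R.
  rewrite card_sphere natrM -mulrA.
  have := draw_mean R s (onesD_subC a b).
  rewrite card_zeros card_onesD (jdistC b) => <-.
  rewrite -(sum_drop R a).
  rewrite -(sum_sphere _ _ (fun=> 1) (fun U => #|U :&: (ones b :\: ones a)|%:R)).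
  by under [RHS]eq_bigr do rewrite mul1r.
rewrite sumr_const -[_ *+ #|_|]mulr_natl -!mulrBr mulrC mulKf // pnatr_eq0 -lt0n //.
Qed.

(** The two hypergeometric factors are independent and have the same bound,
    hence the [2]. *)
Lemma ell_mgf (R : realType) (theta : R) a b (s : nat)
    (S := dsphere (@jdist n w) a s) (k := jdist a b) :
  \sum_(x in S) expR (theta * (ell R (@jdist n w) a b x - mean_ell R s k)) <=
  #|S|%:R * expR (theta ^+ 2 * (2 * (minn s k)%:R)).
Proof.
pose F U := expR (- theta) ^+ #|U :&: (ones a :\: ones b)|.
pose G V := expR (- theta) ^+ #|V :&: (ones b :\: ones a)|.
pose c := expR (theta * (s%:R * k%:R / w%:R) + theta * (s%:R * k%:R / (n - w)%:R)).
have -> : \sum_(x in S) expR (theta * (ell R (@jdist n w) a b x - mean_ell R s k))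
  = c * \sum_(x in S) F (ones a :\: ones x) * G (ones x :\: ones a).
  rewrite mulr_sumr; apply: eq_bigr => x _; rewrite /F /G /c -!expRM_natr -!expRD.
  by congr expR; rewrite ell_cap /mean_ell -/k; ring.
rewrite sum_sphere.
have HF := draw_mgf_le (- theta) s (onesD_sub a b).
have HG := draw_mgf_le (- theta) s (onesD_subC a b).
rewrite card_ones card_onesD -/k in HF.
rewrite card_zeros card_onesD jdistC -/k in HG.
have P (A : {set 'I_n}) (H : {set 'I_n} -> R) : (forall U, 0 <= H U) ->
  0 <= \sum_(U : {set 'I_n} | (U \subset A) && (#|U| == s)) H U.
  by move=> H0; apply: sumr_ge0 => U _.
have := ler_pM (P (ones a) _ _) (P (~: ones a) _ _) HF HG.
move=> /(_ (fun=> exprn_ge0 _ (expR_ge0 _)) (fun=> exprn_ge0 _ (expR_ge0 _))) H.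
apply: (le_trans (ler_wpM2l (expR_ge0 _) H)).
rewrite card_sphere natrM [X in c * X]mulrACA [leLHS]mulrCA -expRD /c -expRD.
rewrite le_eqVlt; apply/orP; left; apply/eqP; congr (_ * expR _); ring.
Qed.
End Slice.

(** * Tail bounds *)

Lemma chernoff (R : realType) (T : finType) (S : {set T}) (Y : T -> R) (v t : R) :
  0 < v -> 0 <= t ->
  (forall theta : R, 0 <= theta ->
     \sum_(x in S) expR (theta * Y x) <= #|S|%:R * expR (theta ^+ 2 * v)) ->
  #|[set x in S | t <= Y x]|%:R <= #|S|%:R * expR (- (t ^+ 2 / (4 * v))).
Proof.
move=> v0 t0 H; (* The minimiser of [theta^2 v - theta t]. *)
set th := t / (2 * v).
have th0 : 0 <= th by rewrite divr_ge0 // mulr_ge0 // ltW.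
rewrite -(ler_pM2r (expR_gt0 (th * t))).
have -> : #|S|%:R * expR (- (t ^+ 2 / (4 * v))) * expR (th * t) =
    #|S|%:R * expR (th ^+ 2 * v).
  rewrite -mulrA -expRD; congr (_ * expR _); rewrite /th; field; exact: lt0r_neq0.
apply: le_trans (H th th0).
rewrite -sum1_card natr_sum mulr_suml.
rewrite (eq_bigl (fun x => (x \in S) && (t <= Y x))); last by move=> x; rewrite !inE.
rewrite big_mkcondr /=; apply: ler_sum => x _; case: ifP => [tY|_].
  by rewrite mul1r ler_expR ler_wpM2l.
exact: expR_ge0.
Qed.

(** * Growth, dispersion and concentration below the critical radius *)

Section SubcriticalRadius.
Variables (R : realType) (eps : R) (n w r : nat).
Hypotheses (eps_gt0 : 0 < eps) (eps_lt1 : eps < 1 / 10) (wn : (w < n)%N).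
Hypothesis r_small : r%:R * n%:R < (1 - eps) * w%:R * (n - w)%:R.
Implicit Types a b x : slice n w.

Local Notation dist := (@jdist n w).

Lemma n_split : n%:R = w%:R + (n - w)%:R :> R.
Proof. by rewrite -natrD subnKC // ltnW. Qed.

Lemma weight_pos : 0 < w%:R :> R /\ 0 < (n - w)%:R :> R.
Proof.
split; last by rewrite ltr0n subn_gt0.
rewrite ltr0n lt0n; apply/negP => /eqP w0; move: r_small.
by rewrite w0 mulr0 mul0r -natrM ltrn0.
Qed.

Lemma radius_lt : r%:R < w%:R :> R /\ r%:R < (n - w)%:R :> R.
Proof.
have [w0 v0] := weight_pos.
have H : r%:R * w%:R + r%:R * (n - w)%:R < w%:R * (n - w)%:R :> R.
  rewrite -mulrDr -n_split; apply: (lt_le_trans r_small).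
  by rewrite -mulrA ler_piMl ?mulr_ge0 ?ler0n // lerBlDr lerDl ltW.
have rw : 0 <= r%:R * w%:R :> R by rewrite mulr_ge0.
have rv : 0 <= r%:R * (n - w)%:R :> R by rewrite mulr_ge0.
split; first by rewrite -(ltr_pM2r v0); lra.
by rewrite -(ltr_pM2l w0); lra.
Qed.

Lemma expR_sqr_le : expR (eps ^+ 2) <= 1 + eps.
Proof.
have e0 := expR_gt0 (eps ^+ 2).
have /(ler_wpM2l (ltW e0)) := expR_ge1Dx (- eps ^+ 2).
rewrite expRxMexpNx_1 => H.
have e2 : eps ^+ 2 <= eps * (1 / 10) by rewrite expr2 ler_pM2l // ltW.
have h1 := eps_gt0; have h2 := eps_lt1.
have d0 : 0 < 1 - eps ^+ 2 by lra.
rewrite -(ler_pM2r d0); apply: (le_trans H).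
have e3 : eps ^+ 2 * eps <= eps ^+ 2 by rewrite ler_piMr ?sqr_ge0 //; lra.
lra.
Qed.

(** With [u = s + 1], the ratio of the two sizes is
    [(w - u + 1)(n - w - u + 1) / u^2], and
    [(w - u)(n - w - u) = w (n - w) - u n + u^2 >= eps w (n - w) + u^2], which
    is at least [(1 + eps) u^2] as [u] is less than [w] and [n - w]. *)
Lemma card_sphere_growth a (s : nat) : (s < r)%N ->
  expR (eps ^+ 2) * #|dsphere dist a s|%:R <= #|dsphere dist a s.+1|%:R.
Proof.
move=> sr; have [w0 nw0] := weight_pos.
set u : R := s.+1%:R.
have u0 : 0 < u by rewrite ltr0n.
have ur : u <= r%:R by rewrite ler_nat.
have [rw rv] := radius_lt.
have [uw unw] : u < w%:R /\ u < (n - w)%:R by split; lra.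
have step (m : nat) : u < m%:R ->
    'C(m, s.+1)%:R * u = 'C(m, s)%:R * (m%:R - u + 1).
  move=> um; have sm : (s <= m)%N by move: um; rewrite /u ltr_nat => /ltnW/ltnW.
  have /(congr1 (fun j => j%:R : R)) := mul_bin_left m s.
  rewrite !natrM natrB // -natr1 => H.
  by rewrite mulrC /u -natr1 H; ring.
rewrite -(ler_pM2r (mulr_gt0 u0 u0)) !card_sphere !natrM [leRHS]mulrACA !step //.
rewrite [leRHS]mulrACA -[leLHS]mulrA [leLHS]mulrCA.
rewrite ler_wpM2l ?mulr_ge0 //.
have q := expR_sqr_le.
have qu : expR (eps ^+ 2) * (u * u) <= (1 + eps) * (u * u).
  by rewrite ler_wpM2r // mulr_ge0 // ltW.
apply: (le_trans qu).
have un : u * n%:R <= r%:R * n%:R by rewrite ler_wpM2r.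
have P1 : r%:R * n%:R <= (1 - eps) * (w%:R * (n - w)%:R) by rewrite mulrA ltW.
have P2 : eps * (u * u) <= eps * (w%:R * (n - w)%:R).
  by rewrite ler_wpM2l ?ltW // ltr_pM // ltW.
have P3 : 0 <= w%:R - u + (n - w)%:R - u by lra.
move: P1 un; rewrite n_split; lra.
Qed.

Lemma card_ball_growth a (s j : nat) : (s + j <= r)%N ->
  expR (eps ^+ 2 * j%:R) * #|dball dist a s|%:R <= #|dball dist a (s + j)%N|%:R.
Proof.
elim: j => [|j IH] sjr; first by rewrite mulr0 expR0 mul1r addn0.
rewrite -natr1 mulrDr mulr1 addrC expRD -mulrA.
have {IH} := IH (leq_trans (leq_add (leqnn s) (leqnSn j)) sjr).
move=> /(ler_wpM2l (expR_ge0 (eps ^+ 2)))/le_trans; apply.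
rewrite addnS card_ball_sum natr_sum mulr_sumr.
rewrite card_ball_sum big_ord_recl natrD natr_sum.
rewrite -[leLHS]add0r; apply: lerD => //.
apply: ler_sum => i _; rewrite lift0; apply: card_sphere_growth.
by have := ltn_ord i; lia.
Qed.

Lemma mean_ell_ge (s k : nat) : (s <= r)%N -> eps * k%:R <= mean_ell n w R s k.
Proof.
move=> sr; have [w0 nw0] := weight_pos.
have -> : mean_ell n w R s k = k%:R * (1 - s%:R * n%:R / (w%:R * (n - w)%:R)).
  rewrite /mean_ell n_split; field; by rewrite !gt_eqF.
rewrite mulrC ler_wpM2l // lerBrDl -lerBrDr ler_pdivrMr ?mulr_gt0 //.
rewrite mulrA; apply: le_trans (ltW r_small).
by rewrite ler_wpM2r // ler_nat.
Qed.

Lemma dsphere_neq0_radius a (z : int) : dsphere dist a z != set0 ->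
  exists s : nat, z = s.
Proof.
by case/set0Pn => x; rewrite inE => /eqP <-; exists (dist x a).
Qed.

Lemma exp_growth_slice : exp_growth dist r (eps ^+ 2).
Proof.
move=> a t t0 tr; case: t t0 tr => // t _; rewrite ltz_nat => tr.
rewrite subzn 1?ltnW //.
have H := @card_ball_growth a (r - t)%N t.
rewrite subnK ?(ltnW tr) // in H; have {}H := H (leqnn r).
rewrite expRN -(ler_pM2l (expR_gt0 (eps ^+ 2 * t%:R))).
have e0 := expR_gt0 (eps ^+ 2 * t%:R).
have -> : expR (eps ^+ 2 * t%:R) *
    (2 * (expR (eps ^+ 2 * t%:~R))^-1 * #|dball dist a r|%:R)
  = 2 * #|dball dist a r|%:R.
  rewrite -pmulrn; field; exact: lt0r_neq0.
by apply: (le_trans H); rewrite ler_peMl // ler1n.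
Qed.

Lemma dispersed_slice k : dispersed dist r k (eps / 2).
Proof.
move=> a b abk i i0 _ S0; have [s E] := dsphere_neq0_radius S0.
rewrite E in S0 *; rewrite ell_mean // abk mulrCA divff ?pnatr_eq0 // mulr1.
by apply: mean_ell_ge; lia.
Qed.

(** The sign [sg] selects the lower or the upper tail.  The bound [m] may be
    taken to be either the radius or the distance: the first choice gives the
    subgaussian property, the second the intersection bound. *)
Lemma ell_tail a b (s m : nat) (sg t : R) : sg ^+ 2 = 1 -> 0 <= t ->
  (0 < m)%N -> (minn s (dist a b) <= m)%N ->
  #|[set x in dsphere dist a s |
     t <= sg * (ell R dist a b x - mean_ell n w R s (dist a b))]|%:R <=
  #|dsphere dist a s|%:R * expR (- (t ^+ 2 / (8 * m%:R))).
Proof.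
move=> sg1 t0 m0 sm.
have v0 : 0 < 2 * m%:R :> R by rewrite mulr_gt0 // ltr0n.
rewrite (_ : 8 * m%:R = 4 * (2 * m%:R)); last by ring.
apply: chernoff => // theta _; under eq_bigr do rewrite mulrA.
apply: (le_trans (ell_mgf (theta * sg) a b s)).
rewrite exprMn sg1 mulr1 ler_wpM2l // ler_expR ler_wpM2l ?sqr_ge0 //.
by rewrite ler_wpM2l // ler_nat.
Qed.

Lemma ell_subgaussian a b (s m : nat) : (0 < m)%N ->
  (minn s (dist a b) <= m)%N -> dsphere dist a s != set0 ->
  subgaussian (dsphere dist a s)
    (fun x => ell R dist a b x - unif_E (dsphere dist a s) (ell R dist a b))
    (8 * m%:R).
Proof.
move=> m0 sm S0 t t0; rewrite ell_mean // /unif_P.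
have Hp := ell_tail (expr1n _ _) t0 m0 sm.
have Hn := ell_tail (etrans (sqrrN _) (expr1n _ _)) t0 m0 sm.
rewrite ler_pdivrMr ?ltr0n ?card_gt0 //.
move: Hp Hn; set mu := mean_ell _ _ _ _ _; set P := [set x in _ | _].
set Q := [set x in _ | _] => Hp Hn; set E := [set x in _ | _].
have : #|E|%:R <= #|P|%:R + #|Q|%:R :> R.
  rewrite -natrD ler_nat; apply: leq_trans (leq_card_setU _ _).
  apply: subset_leq_card; apply/subsetP => x; rewrite !inE => /andP[-> /=].
  by rewrite mul1r mulN1r -lerNr ler_normr lerNr.
lra.
Qed.

(** The first exponential counts the points far inside the ball around [a], the
    second one those for which [ell] is atypically small; summing the tail
    bound over the spheres rebuilds the ball. *)
Lemma card_ball_cap a b (al := eps / 2) (k := dist a b) : (0 < k)%N ->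
  #|dball dist a r :&: dball dist b r|%:R <=
  (expR (- (eps ^+ 2 * (al * k%:R))) + expR (- (al ^+ 2 * k%:R / 8)))
   * #|dball dist a r|%:R.
Proof.
move=> k0; set I := _ :&: _.
have al0 : 0 <= al by rewrite divr_ge0 // ltW.
have alk0 : 0 <= al * k%:R by rewrite mulr_ge0.
set t := Num.trunc (al * k%:R).
have tle : t%:R <= al * k%:R by have /andP[] := truncn_itv alk0.
have tlt : al * k%:R < t.+1%:R by have /andP[] := truncn_itv alk0.
(* [P] holds near the boundary of the ball, at depth at most [al * k]; its
   complement is the ball of radius [r - t.+1] if [t < r], and empty otherwise. *)
pose P x := (r <= t + dist x a)%N.
rewrite -(cardsID [set x | P x]) natrD addrC mulrDl; apply: lerD.
  have [tr|rt] := ltnP t r; last first.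
    rewrite (_ : _ :\: _ = set0) ?cards0 ?mulr_ge0 ?expR_ge0 //.
    by apply/setP => x; rewrite !inE /P (leq_trans rt (leq_addr _ _)).
  have H := @card_ball_growth a (r - t.+1) t.+1.
  rewrite subnK // in H; have {}H := H (leqnn r).
  rewrite expRN mulrC ler_pdivlMr ?expR_gt0 // mulrC.
  apply: le_trans H; apply: ler_pM; rewrite ?expR_ge0 //.
    by rewrite ler_expR ler_wpM2l ?sqr_ge0 // ltW.
  rewrite ler_nat; apply: subset_leq_card; apply/subsetP => x.
  by rewrite in_setD in_setI !in_ball inE /P; lia.
have -> : #|I :&: [set x | P x]|%:R =
    \sum_(x in dball dist a r) (if (dist x b <= r)%N && P x then 1 else 0) :> R.
  rewrite -big_mkcondr -sum1_card natr_sum; apply: eq_bigl => x.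
  by rewrite in_setI in_setI !in_ball inE andbA.
rewrite sum_ball card_ball_sum natr_sum mulr_sumr; apply: ler_sum => s _.
have sr : (s <= r)%N by rewrite -ltnS ltn_ord.
have T := @ell_tail a b s k (-1) (al * k%:R) (etrans (sqrrN _) (expr1n _ _))
  alk0 k0 (geq_minr _ _).
rewrite (_ : al ^+ 2 * k%:R / 8 = (al * k%:R) ^+ 2 / (8 * k%:R)); last first.
  by field; rewrite pnatr_eq0 -lt0n.
rewrite mulrC; apply: le_trans T.
rewrite -big_mkcondr -(natr_sum R _ _ (fun=> 1%N)) sum1_card ler_nat.
apply: subset_leq_card; apply/subsetP => x.
rewrite unfold_in inE in_sphere => /andP[/eqP xs /andP[xb]].
rewrite /P xs eqxx /= => rts.
have mu := mean_ell_ge k sr.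
rewrite /ell xs.
have h1 : (dist x b)%:R <= r%:R :> R by rewrite ler_nat.
have h2 : r%:R <= t%:R + s%:R :> R by rewrite -natrD ler_nat.
move: mu; rewrite -/k /al in tle h2 *; lra.
Qed.

(** When the balls meet, [k <= 2 r], so [k + k^2 / r <= 3 k] and the linear
    rates [eps^3 / 2] and [eps^2 / 32] of [card_ball_cap], both at least
    [eps^3 / 4] for [eps <= 1/10], are enough. *)
Lemma ball_cap_bound a b (c : R) : 0 <= c -> c <= eps ^+ 3 / 12 -> (0 < r)%N ->
  #|dball dist a r :&: dball dist b r|%:R / #|dball dist a r|%:R
  <= 2 * expR (- (c * ((dist a b)%:R + (dist a b)%:R ^+ 2 / r%:R))).
Proof.
move=> c0 c1 r0.
have B0 : 0 < #|dball dist a r|%:R :> R.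
  rewrite ltr0n card_gt0; apply/set0Pn; exists a.
  by rewrite in_ball -card_onesD setDv cards0.
rewrite ler_pdivrMr //; set k := dist a b.
have [k0|k0] := posnP k.
  rewrite k0 expr0n /= mul0r addr0 mulr0 oppr0 expR0 mulr1.
  apply: (@le_trans _ _ #|dball dist a r|%:R); last by rewrite ler_peMl // ler1n.
  by rewrite ler_nat subset_leq_card // subsetIl.
have [->|] := set_0Vmem (dball dist a r :&: dball dist b r).
  by rewrite cards0 !mulr_ge0 // expR_ge0.
case=> x; rewrite in_setI !in_ball => /andP[xa xb].
have kr : (k <= 2 * r)%N.
  have := jdist_triangle a x b; rewrite (jdistC a x) -/k; lia.
apply: (le_trans (card_ball_cap k0)); rewrite ler_wpM2r //.
have r0' : 0 < r%:R :> R by rewrite ltr0n.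
have kr' : k%:R ^+ 2 / r%:R <= 2 * k%:R :> R.
  rewrite ler_pdivrMr // expr2 mulrAC ler_wpM2r // -natrM ler_nat //.
have h1 := eps_gt0; have h2 := eps_lt1.
have e3 : 0 <= eps ^+ 3 by rewrite exprn_ge0 // ltW.
have e32 : eps ^+ 3 <= eps ^+ 2 / 10.
  by rewrite exprSr ler_wpM2l ?sqr_ge0 // ltW // -div1r.
have X : c * (k%:R + k%:R ^+ 2 / r%:R) <= eps ^+ 3 / 4 * k%:R.
  apply: (@le_trans _ _ (eps ^+ 3 / 12 * (3 * k%:R))); last by lra.
  apply: ler_pM => //; last by lra.
  by rewrite addr_ge0 // divr_ge0 // sqr_ge0.
rewrite mulrDl !mul1r; apply: lerD; rewrite ler_expR lerN2 (le_trans X) //.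
  have -> : eps ^+ 2 * (eps / 2 * k%:R) = eps ^+ 3 / 2 * k%:R by ring.
  by rewrite ler_wpM2r //; lra.
rewrite [leRHS]mulrAC ler_wpM2r // exprMn; lra.
Qed.
End SubcriticalRadius.

Theorem lemma4p3 (R : realType) (eps : R) (eps_gt0 : 0 < eps)
    (eps_lt : eps < 1 / 10) :
  exists2 c' : R, 0 < c' &
  forall (lambda beta : R) (n w r k : nat),
    0 < lambda -> lambda < 1 ->
    0 < beta -> beta < (1 - eps) * lambda * (1 - lambda) ->
    (0 < n)%N -> lambda * n%:R = w%:R -> beta * n%:R = r%:R ->
    (0 < k)%N ->
    [/\ exp_growth (@jdist n w) r (eps ^+ 2),
        dispersed (@jdist n w) r k (eps / 2),
        forall a b : slice n w, jdist a b = k ->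
        forall i : int, 0 <= i -> i%:~R <= eps * k%:R ->
          let S := dsphere (@jdist n w) a (r%:Z - i) in
          let L := ell R (@jdist n w) a b in
          S != set0 ->
          subgaussian S (fun x => L x - unif_E S L) (8 * beta * n%:R)
      & forall a b : slice n w,
          #|dball (@jdist n w) a r :&: dball (@jdist n w) b r|%:R
            / #|dball (@jdist n w) a r|%:R
          <= 2 * expR (- (c' * ((jdist a b)%:R
                               + (jdist a b)%:R ^+ 2 / (beta * n%:R)))) :> R].
Proof.
exists (eps ^+ 3 / 12); first by rewrite divr_gt0 // exprn_gt0.
move=> lambda beta n w r k l0 l1 b0 b1 n0 lw br k0.
have n0' : 0 < n%:R :> R by rewrite ltr0n.
have wn : (w < n)%N by rewrite -(ltr_nat R) -lw gtr_pMl.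
have r0 : (0 < r)%N by rewrite -(ltr0n R) -br mulr_gt0.
have rs : r%:R * n%:R < (1 - eps) * w%:R * (n - w)%:R.
  rewrite natrB 1?ltnW // -lw -br.
  have -> : (1 - eps) * (lambda * n%:R) * (n%:R - lambda * n%:R) =
    (1 - eps) * lambda * (1 - lambda) * n%:R * n%:R by ring.
  by rewrite !ltr_pM2r.
split.
- exact: exp_growth_slice rs.
- exact: dispersed_slice rs _.
- move=> a b _ i i0 _; cbv zeta => S0; have [s E] := dsphere_neq0_radius S0.
  rewrite -mulrA br E in S0 *; apply: ell_subgaussian => //.
  by apply: leq_trans (geq_minl _ _) _; lia.
- move=> a b; rewrite br; apply: ball_cap_bound rs _ _ _ _ _ _ => //.
  by rewrite divr_ge0 // exprn_ge0 // ltW.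
Qed.
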